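(* Let $V$ be a vector space over a field $k$ and let $\varphi\in\mathrm{End}_k(V)$ be a finite potent endomorphism of index $m$ with AST decomposition $V=W_\varphi\oplus U_\varphi$, and let $r=\dim_k W_\varphi$. Then there exists a bijection $$X_\varphi(1GD)\;\simeq\;\prod_{j=1}^{r}\ker\varphi\;\times\;\prod_{\substack{s_i\in S_{\mu_i(U_\varphi,\varphi)}\\ 1\le i\le m}}\Big[(U_\varphi/\ker\varphi)\times\prod_{j=1}^{i-1}\ker\varphi\Big].$$
   Context: $k$ is an arbitrary field, $V$ an arbitrary (possibly infinite-dimensional) $k$-vector space. An endomorphism $\varphi\in\mathrm{End}_k(V)$ is finite potent if $\varphi^n(V)$ is finite dimensional for some $n\ge 1$. For such $\varphi$ there is a unique $\varphi$-invariant decomposition $V=W_\varphi\oplus U_\varphi$ (the AST decomposition) with $W_\varphi$ finite dimensional, $\varphi|_{W_\varphi}$ an automorphism of $W_\varphi$, and $\varphi|_{U_\varphi}$ nilpotent (so $\ker\varphi\subseteq U_\varphi$); the index $i(\varphi)$ is the nilpotency order of $\varphi|_{U_\varphi}$ ($i(\varphi)=0$ iff $V$ is finite dimensional and $\varphi$ is an automorphism). A $\{1\}$-inverse of $\varphi$ is $\varphi^-\in\mathrm{End}_k(V)$ with $\varphi\varphi^-\varphi=\varphi$; the set of them is $X_\varphi(1)$. A G-Drazin inverse of $\varphi$ is $\varphi^{GD}\in\mathrm{End}_k(V)$ with $\varphi\varphi^{GD}\varphi=\varphi$ and $\varphi^{GD}\varphi^m=\varphi^m\varphi^{GD}$, where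 $m=i(\varphi)$; the set of them is $X_\varphi(GD)$. $X_\varphi(1GD)$ is the set of 1GD inverses of $\varphi$, i.e. of $\psi\in\mathrm{End}_k(V)$ such that $\psi\varphi\psi=\psi$, $\psi\varphi=\varphi^-\varphi$ and $\varphi\psi=\varphi\varphi^{GD}$ for some $\varphi^-\in X_\varphi(1)$ and $\varphi^{GD}\in X_\varphi(GD)$. Index sets: writing $g=\varphi|_{U_\varphi}$ (nilpotent on $U_\varphi$), for $1\le i\le m$ let $\mu_i(U_\varphi,\varphi)=\dim_k\big(\ker g^i/[\ker g^{i-1}+g(\ker g^{i+1})]\big)$ (possibly an infinite cardinal), and let $S_{\mu_i(U_\varphi,\varphi)}$ be a set of cardinality $\mu_i(U_\varphi,\varphi)$, these sets being pairwise disjoint for different $i$. (So $S_{\mu_i(U_\varphi,\varphi)}$ indexes the Jordan chains of length $i$ in a Jordan basis of $U_\varphi$ for $\varphi|_{U_\varphi}$.) The product over $s_i$ runs over all $i\in\{1,\dots,m\}$ and all $s_i\in S_{\mu_i(U_\varphi,\varphi)}$; ''bijection'' means bijection of sets. *)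

(* Defs.v *)
From HB Require Import structures.
From mathcomp Require Import all_boot all_order all_algebra.
From mathcomp Require Import boolp classical_sets functions.

Set Implicit Arguments.
Unset Strict Implicit.
Unset Printing Implicit Defensive.

Import GRing.Theory.

Local Open Scope ring_scope.
Local Open Scope classical_set_scope.

Section LinearAlgebra.
Variables (k : fieldType) (V : lmodType k).
Implicit Types (A B W U : set V) (f : {linear V -> V}).

Definition is_subspace A : Prop := submod_closed [in A].

Definition add_sets A B : set V := [set x + y | x in A & y in B].

(* [has_dim_quot A B S] : dim_k (A / B) is the cardinality of S, i.e. A / B has a
   basis indexed by S.  The basis is given by representatives [b s] in A of its
   elements; S is an arbitrary type, so finite linear combinations are indexed
   by finite injective families in S. *)
Definition has_dim_quot A B (S : Type) : Prop :=
  exists b : S -> V,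
    [/\ forall s, A (b s),
        forall (n : nat) (s : 'I_n -> S) (c : 'I_n -> k), injective s ->
          B (\sum_(j < n) c j *: b (s j)) -> forall j, c j = 0 &
        forall v, A v -> exists (n : nat) (s : 'I_n -> S) (c : 'I_n -> k),
          injective s /\ B (v - \sum_(j < n) c j *: b (s j))].

Definition has_dim A (S : Type) : Prop := has_dim_quot A [set 0] S.

Definition finite_dim A : Prop := exists r : nat, has_dim A 'I_r.

Definition ker f : set V := [set v | f v = 0].

(* A / B, as the set of cosets a + B with a in A. *)
Definition quot A B : set (set V) := [set [set a + b | b in B] | a in A].

Definition finite_potent f : Prop :=
  exists2 n : nat, (1 <= n)%N & finite_dim (range (iter n f)).

Definition nilpotent_on f U (n : nat) : Prop :=
  forall u, U u -> iter n f u = 0.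

Definition AST_decomposition f W U : Prop :=
  [/\ is_subspace W /\ is_subspace U,
      add_sets W U = setT /\ W `&` U = [set 0],
      set_fun W W f /\ set_fun U U f,
      finite_dim W /\ set_bij W W f &
      exists n, nilpotent_on f U n].

(* The nilpotency order of f on U is the least n >= 0 with f^n = 0 on U; in
   particular the index is 0 exactly when U = 0. *)
Definition has_index f (m : nat) : Prop :=
  exists W U, [/\ AST_decomposition f W U, nilpotent_on f U m &
    forall n, nilpotent_on f U n -> (m <= n)%N].

Definition X_1 f : set {linear V -> V} :=
  [set h : {linear V -> V} | f \o h \o f =1 f].

Definition X_GD f : set {linear V -> V} :=
  [set h : {linear V -> V} | f \o h \o f =1 f /\
    exists2 m, has_index f m & h \o iter m f =1 iter m f \o h].

Definition X_1GD f : set {linear V -> V} :=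
  [set p : {linear V -> V} | p \o f \o p =1 p /\
    exists h g : {linear V -> V}, [/\ X_1 f h, X_GD f g, p \o f =1 h \o f & f \o p =1 f \o g]].

(* ker (f|_U)^i, as a subset of V. *)
Definition ker_on f U (i : nat) : set V := [set u | U u /\ iter i f u = 0].

(* [has_mu f U i S] : mu_i(U, f) is the cardinality of S (meant for i >= 1). *)
Definition has_mu f U (i : nat) (S : Type) : Prop :=
  has_dim_quot (ker_on f U i)
    (add_sets (ker_on f U i.-1) (f @` ker_on f U i.+1)) S.

End LinearAlgebra.

(* Main.v *)
(* An inverse p in X_phi(1GD) is determined by the two idempotents p phi and
   phi p, because p = p phi p. The first is an arbitrary projection with kernel
   ker phi, so it is given by a linear map V / ker phi -> ker phi; the second
   is an arbitrary projection onto im phi that preserves U, so it is given by a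
   linear map U / phi(U) -> phi(U), where phi(U) ~ U / ker phi. Jordan chains
   b_s, phi b_s, ..., phi^(i-1) b_s (s in S_{mu_i}) form a basis of U in which
   the b_s are a basis of U mod phi(U) and the phi^j b_s with j < i - 1 are a
   basis of U mod ker phi. Hence free choices of the values phi p b_s and
   p phi (phi^j b_s), together with the values of p phi on a basis of W,
   parametrize X_phi(1GD). *)
Require Import Defs.
From HB Require Import structures.
From mathcomp Require Import all_boot all_order all_algebra.
From mathcomp Require Import zify.
From mathcomp Require Import boolp classical_sets functions.

Set Implicit Arguments.
Unset Strict Implicit.
Unset Printing Implicit Defensive.

Import GRing.Theory.

Local Open Scope ring_scope.
Local Open Scope classical_set_scope.

(** * Subspaces, bases of quotients, linear independence *)

Section Subspaces.
Variables (k : fieldType) (V : lmodType k).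
Implicit Types A B C : set V.

Lemma is_subspaceP A :
  is_subspace A <-> A 0 /\ forall a u v, A u -> A v -> A (a *: u + v).
Proof.
split=> [[A0 Alin]|[A0 Alin]]; split.
- by move: A0; rewrite inE.
- by move=> a u v Au Av; apply/set_mem/Alin; apply/mem_set.
- by rewrite inE.
- by move=> a u v /set_mem Au /set_mem Av; apply/mem_set/Alin.
Qed.

Lemma subspace0 A : is_subspace A -> A 0.
Proof. by case/is_subspaceP. Qed.

Lemma subspaceZ A a u : is_subspace A -> A u -> A (a *: u).
Proof. by case/is_subspaceP=> A0 Alin Au; rewrite -[_ *: _]addr0; apply: Alin. Qed.

Lemma subspaceD A u v : is_subspace A -> A u -> A v -> A (u + v).
Proof. by case/is_subspaceP=> _ Alin Au Av; rewrite -[u]scale1r; apply: Alin. Qed.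

Lemma subspaceN A u : is_subspace A -> A u -> A (- u).
Proof. by move=> sA Au; rewrite -scaleN1r; apply: subspaceZ. Qed.

Lemma subspaceB A u v : is_subspace A -> A u -> A v -> A (u - v).
Proof. by move=> sA Au Av; apply: subspaceD => //; apply: subspaceN. Qed.

Lemma subspace_sum A (J : Type) (q : seq J) (P : pred J) (F : J -> V) :
  is_subspace A -> (forall x, P x -> A (F x)) -> A (\sum_(x <- q | P x) F x).
Proof.
move=> sA AF; apply: big_ind => //; first exact: subspace0.
by move=> u v Au Av; apply: subspaceD.
Qed.

Lemma subspace_sum_seq A (J : eqType) (q : seq J) (F : J -> V) :
  is_subspace A -> {in q, forall x, A (F x)} -> A (\sum_(x <- q) F x).
Proof.
by move=> sA AF; rewrite big_seq; apply: subspace_sum.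
Qed.

Lemma subspace_add A B :
  is_subspace A -> is_subspace B -> is_subspace (add_sets A B).
Proof.
move=> sA sB; apply/is_subspaceP; split.
  by exists 0; [exact: subspace0|exists 0; [exact: subspace0|rewrite addr0]].
move=> a _ _ [x Ax [y By <-]] [x' Ax' [y' By' <-]].
exists (a *: x + x'); first by apply: subspaceD => //; apply: subspaceZ.
exists (a *: y + y'); first by apply: subspaceD => //; apply: subspaceZ.
by rewrite scalerDr addrACA.
Qed.

Lemma subspace_setI A B :
  is_subspace A -> is_subspace B -> is_subspace (A `&` B).
Proof.
move=> sA sB; apply/is_subspaceP; split; first by split; apply: subspace0.
by move=> a u v [Au Bu] [Av Bv]; split; apply: subspaceD => //; apply: subspaceZ.
Qed.

Lemma subspace_image (f : {linear V -> V}) A :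
  is_subspace A -> is_subspace (f @` A).
Proof.
move=> sA; apply/is_subspaceP; split.
  by exists 0; [exact: subspace0|rewrite linear0].
move=> a _ _ [x Ax <-] [y Ay <-]; exists (a *: x + y); last by rewrite linearP.
by apply: subspaceD => //; apply: subspaceZ.
Qed.

Lemma subspace_preimage (f : {linear V -> V}) A :
  is_subspace A -> is_subspace (f @^-1` A).
Proof.
move=> sA; apply/is_subspaceP; split; first by rewrite /= linear0; apply: subspace0.
move=> a u v /= Au Av; rewrite linearP.
by apply: subspaceD => //; apply: subspaceZ.
Qed.

Lemma subspace_eq (f g : {linear V -> V}) : is_subspace [set v | f v = g v].
Proof.
apply/is_subspaceP; split=> [|a u v /= eu ev]; first by rewrite /= !linear0.
by rewrite !linearP eu ev.
Qed.

Lemma subspace_ker (f : {linear V -> V}) : is_subspace (ker f).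
Proof.
apply/is_subspaceP; split=> [|a u v /= eu ev]; first by rewrite /ker/= linear0.
by rewrite /ker/= linearP eu ev scaler0 addr0.
Qed.

Lemma dim_quot_ind A B C (S : Type) (b : S -> V) : is_subspace C ->
  (forall v, A v -> exists (n : nat) (s : 'I_n -> S) (c : 'I_n -> k),
     injective s /\ B (v - \sum_(j < n) c j *: b (s j))) ->
  (forall s, C (b s)) -> B `<=` C -> A `<=` C.
Proof.
move=> sC span Cb BC v /span[n [s [c [_ /BC Cv]]]].
rewrite -(subrK (\sum_(j < n) c j *: b (s j)) v); apply: subspaceD => //.
by apply: subspace_sum => // j _; apply: subspaceZ.
Qed.

(** Moves independence from ordinal-indexed families to duplicate-free lists in another index type.
    As [g] is a function, distinct entries of [q] come from distinct elements of [S]. *)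
Lemma dim_quot_indep B (S : Type) (b : S -> V) (J : eqType) (g : S -> J)
    (e : J -> V) (q : seq J) (a : J -> k) :
  (forall (n : nat) (s : 'I_n -> S) (c : 'I_n -> k), injective s ->
     B (\sum_(j < n) c j *: b (s j)) -> forall j, c j = 0) ->
  uniq q -> {in q, forall y, exists2 s, y = g s & e y = b s} ->
  B (\sum_(y <- q) a y *: e y) -> {in q, forall y, a y = 0}.
Proof.
move=> ind uq qg Bsum.
have /choice[s sP] (j : 'I_(size q)) :
    exists s, tnth (in_tuple q) j = g s /\ e (tnth (in_tuple q) j) = b s.
  by have [s] := qg _ (mem_tnth j (in_tuple q)); exists s.
have s_inj : injective s.
  move=> i j sij; have [+ _] := sP i; have [+ _] := sP j.
  by rewrite sij => <-; apply/tuple_uniqP.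
have := ind _ s (fun j => a (tnth (in_tuple q) j)) s_inj.
rewrite big_tnth in Bsum.
under eq_bigr do rewrite -(sP _).2.
by move=> /(_ Bsum) a0 y /(tnthP (in_tuple q))[j ->].
Qed.

(** Duplicate-free lists require decidable equality on [J]; an arbitrary index type enters as
    [{classic J}]. *)
Definition independent (J : eqType) (e : J -> V) : Prop :=
  forall (q : seq J) (a : J -> k), uniq q ->
    \sum_(x <- q) a x *: e x = 0 -> {in q, forall x, a x = 0}.

(* By induction on the rank: once the coefficients of smaller rank vanish, the
   terms of rank [rho x] sum to zero modulo [B]. *)
Lemma graded_independent (J : eqType) (e : J -> V) (rho : J -> nat) :
  (forall x, exists B, [/\ is_subspace B,
     forall y, (rho x < rho y)%N -> B (e y) &
     forall (q : seq J) (a : J -> k), uniq q -> {in q, forall y, rho y = rho x} ->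
       B (\sum_(y <- q) a y *: e y) -> {in q, forall y, a y = 0}]) ->
  independent e.
Proof.
move=> eB q a uq sum0 x.
have [n] := ubnP (rho x); elim: n x => // n IH x /ltnSE xn xq.
have [B [sB Be /(_ [seq y <- q | rho y == rho x] a)]] := eB x.
apply; first by rewrite filter_uniq.
- by move=> y; rewrite mem_filter => /andP[/eqP].
- rewrite big_filter -[X in B X]opprK; apply: subspaceN => //.
  move: sum0; rewrite (bigID (fun y => rho y == rho x)) /= => /eqP.
  rewrite addr_eq0 => /eqP->; rewrite opprK big_seq_cond.
  apply: subspace_sum => // y /andP[yq]; rewrite neq_ltn => /orP[] lty.
    by rewrite IH ?scale0r//; [exact: subspace0|exact: leq_trans xn].
  by apply: subspaceZ => //; apply: Be.
- by rewrite mem_filter eqxx.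
Qed.

End Subspaces.

(** * Linear maps: extension from a basis, extensionality, iterates *)

Section LinearExtension.
Variables (k : fieldType) (V V' : lmodType k) (J : eqType).

(** Indices may repeat in a formal combination, so that addition is concatenation. *)
Let comb (U : lmodType k) (f : J -> U) (r : seq (k * J)) : U :=
  \sum_(p <- r) p.1 *: f p.2.

Let scale_seq (a : k) (r : seq (k * J)) := [seq (a * p.1, p.2) | p <- r].

Let comb_scale (U : lmodType k) (f : J -> U) a r :
  comb f (scale_seq a r) = a *: comb f r.
Proof.
by rewrite /comb big_map scaler_sumr; apply: eq_bigr => p _; rewrite scalerA.
Qed.

Let comb_cat (U : lmodType k) (f : J -> U) r1 r2 :
  comb f (r1 ++ r2) = comb f r1 + comb f r2.
Proof. exact: big_cat. Qed.

Let comb_collect (U : lmodType k) (f : J -> U) r :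
  comb f r = \sum_(x <- undup (map snd r)) (\sum_(p <- r | p.2 == x) p.1) *: f x.
Proof.
transitivity (\sum_(x <- undup (map snd r)) \sum_(p <- r | p.2 == x) p.1 *: f p.2).
  rewrite (exchange_big_dep predT)//= /comb big_seq [RHS]big_seq.
  apply: eq_bigr => p pr.
  rewrite (big_rem p.2) ?mem_undup ?map_f//= eqxx big1_seq ?addr0// => x.
  by rewrite rem_filter ?undup_uniq// mem_filter /= eq_sym => /andP[/eqP->]; rewrite eqxx.
by apply: eq_bigr => x _; rewrite scaler_suml; apply: eq_bigr => p /eqP->.
Qed.

(** A chosen expansion of [v] along [e] is evaluated along [t]. Independence makes the value the
    same for every expansion of [v], whence linearity. *)
Lemma linear_extension (e : J -> V) (t : J -> V') :
  independent e ->
  (forall C, is_subspace C -> (forall x, C (e x)) -> forall v, C v) ->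
  exists h : {linear V -> V'}, forall x, h (e x) = t x.
Proof.
move=> ind span.
have comb0 r : comb e r = 0 -> comb t r = 0.
  rewrite !comb_collect => /ind; rewrite undup_uniq => /(_ isT) a0.
  by apply: big1_seq => x /andP[_ xr]; rewrite a0 ?scale0r.
have /choice[rep repE] v : exists r, v = comb e r.
  apply: (span [set v | exists r, v = comb e r]) => [|x].
    apply/is_subspaceP; split; first by exists [::]; rewrite /comb big_nil.
    move=> a _ _ [r1 ->] [r2 ->]; exists (scale_seq a r1 ++ r2).
    by rewrite comb_cat comb_scale.
  by exists [:: (1, x)]; rewrite /comb big_seq1 scale1r.
pose h v := comb t (rep v).
have h_comb v r : v = comb e r -> h v = comb t r.
  move=> vE; apply/eqP; rewrite -subr_eq0 -[- _]scaleN1r -comb_scale -comb_cat.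
  by apply/eqP/comb0; rewrite comb_cat comb_scale scaleN1r -repE -vE subrr.
have h_lin : linear h.
  move=> a u v; rewrite -comb_scale -comb_cat; apply: h_comb.
  by rewrite comb_cat comb_scale -!repE.
pose hL : {linear V -> V'} := HB.pack h (GRing.isLinear.Build k V V' _ h h_lin).
exists hL => x /=.
by rewrite (h_comb _ [:: (1, x)]) /comb big_seq1 scale1r.
Qed.

End LinearExtension.

Lemma linear_ext (k : fieldType) (V V' : lmodType k) (f g : {linear V -> V'}) :
  f =1 g -> f = g.
Proof.
case: f => f [[f1] [f2]]; case: g => g [[g1] [g2]] /= /funext fg.
move: fg f1 f2 g1 g2 => -> f1 f2 g1 g2.
by rewrite (Prop_irrelevance f1 g1) (Prop_irrelevance f2 g2).
Qed.

Section Iter.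
Variables (k : fieldType) (V : lmodType k) (f : {linear V -> V}).

Lemma iter_is_linear n : linear (iter n f).
Proof. by elim: n => // n IH a u v; rewrite !iterS IH linearP. Qed.

HB.instance Definition _ n :=
  GRing.isLinear.Build k V V _ (iter n f) (iter_is_linear n).

End Iter.

(** * The AST decomposition *)

Section AST.
Variables (k : fieldType) (V : lmodType k) (phi : {linear V -> V}).
Variables (W U : set V).
Hypothesis ast : AST_decomposition phi W U.

Lemma AST_subspaceW : is_subspace W. Proof. by case: ast => -[]. Qed.

Lemma AST_subspaceU : is_subspace U. Proof. by case: ast => -[]. Qed.

Lemma AST_stableU u : U u -> U (phi u).
Proof. by case: ast => _ _ [_ +] _ _; apply. Qed.

Lemma AST_stableW u : W u -> W (phi u).
Proof. by case: ast => _ _ [+ _] _ _; apply. Qed.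

Lemma AST_split v : exists w u, [/\ W w, U u & v = w + u].
Proof.
case: ast => _ [WUT _] _ _ _.
have : add_sets W U v by rewrite WUT.
by case=> w Ww [u Uu <-]; exists w, u.
Qed.

Lemma AST_disjoint v : W v -> U v -> v = 0.
Proof.
case: ast => _ [_ WU0] _ _ _ Wv Uv.
by have : (W `&` U) v by []; rewrite WU0.
Qed.

Lemma AST_surjW w : W w -> exists2 w', W w' & phi w' = w.
Proof. by case: ast => _ _ _ [_ [_ _ +]] _ => /[apply]. Qed.

Lemma AST_injW w : W w -> phi w = 0 -> w = 0.
Proof.
case: ast => _ _ _ [_ [_ + _]] _ => inj Ww w0.
have W0 := subspace0 AST_subspaceW.
by apply: inj; rewrite ?linear0 ?inE.
Qed.

Lemma AST_iterW n w : W w -> W (iter n phi w).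
Proof. by elim: n => // n IH Ww; apply/AST_stableW/IH. Qed.

Lemma AST_iterU n u : U u -> U (iter n phi u).
Proof. by elim: n => // n IH Uu; apply/AST_stableU/IH. Qed.

Lemma AST_iter_injW n w : W w -> iter n phi w = 0 -> w = 0.
Proof.
move=> Ww; elim: n => // n IH w0.
by apply: IH; apply: AST_injW => //; apply: AST_iterW.
Qed.

(** For v = w + u, phi^n w = - phi^n u lies in both W and U, so it is 0; and phi^n is injective on
    W. *)
Lemma AST_sub_iter_ker n v : iter n phi v = 0 -> U v.
Proof.
have [w [u [Ww Uu ->]]] := AST_split v; rewrite linearD /= => /eqP.
rewrite addr_eq0 => /eqP wu0.
suff -> : w = 0 by rewrite add0r.
apply: (@AST_iter_injW n) => //; apply: AST_disjoint; first exact: AST_iterW.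
by rewrite wu0; apply: subspaceN; [exact: AST_subspaceU|exact: AST_iterU].
Qed.

Lemma AST_preimU v : U (phi v) -> U v.
Proof.
case: (ast) => _ _ _ _ [n nilU] Uv.
by apply: (@AST_sub_iter_ker n.+1); rewrite iterSr nilU.
Qed.

End AST.

(** [has_index] may come with another decomposition (W', U'). Both U and U' contain every vector
    killed by a power of phi and are killed by one, so they coincide. *)
Lemma AST_ker_iter (k : fieldType) (V : lmodType k) (phi : {linear V -> V})
    (W U : set V) (m : nat) :
  AST_decomposition phi W U -> has_index phi m ->
  forall v, U v <-> iter m phi v = 0.
Proof.
move=> ast [W' [U' [ast' nilU' _]]] v; split; last exact: (AST_sub_iter_ker ast).
case: (ast) => _ _ _ _ [n nilU] /nilU.
by move=> /(AST_sub_iter_ker ast')/nilU'.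
Qed.

(** * A Jordan basis of V adapted to W and U *)

Section JordanBasis.
Variables (k : fieldType) (V : lmodType k) (phi : {linear V -> V}).
Variables (m r : nat) (W U : set V) (S : 'I_m -> Type).
Variables (w : 'I_r -> V) (b : forall i, S i -> V).
Arguments b {i}.
Hypothesis ast : AST_decomposition phi W U.
Hypothesis nilU : nilpotent_on phi U m.

(** The denominator of mu_(i+1), as the ordinal [i] stands for length i + 1. *)
Let mu_denom i := add_sets (ker_on phi U i) (phi @` ker_on phi U i.+2).

Hypothesis wW : forall j, W (w j).
Hypothesis w_ind : forall (n : nat) (s : 'I_n -> 'I_r) (c : 'I_n -> k), injective s ->
  [set 0] (\sum_(j < n) c j *: w (s j)) -> forall j, c j = 0.
Hypothesis w_span : forall v, W v -> exists (n : nat) (s : 'I_n -> 'I_r) (c : 'I_n -> k),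
  injective s /\ [set 0] (v - \sum_(j < n) c j *: w (s j)).
Hypothesis b_ker : forall i (z : S i), ker_on phi U i.+1 (b z).
Hypothesis b_ind : forall i (n : nat) (s : 'I_n -> S i) (c : 'I_n -> k), injective s ->
  mu_denom i (\sum_(j < n) c j *: b (s j)) -> forall j, c j = 0.
Hypothesis b_span : forall (i : 'I_m) v, ker_on phi U i.+1 v ->
  exists (n : nat) (s : 'I_n -> S i) (c : 'I_n -> k),
  injective s /\ mu_denom i (v - \sum_(j < n) c j *: b (s j)).

Let sW := AST_subspaceW ast.
Let sU := AST_subspaceU ast.

Lemma ker_on_subspace i : is_subspace (ker_on phi U i).
Proof. exact: (subspace_setI sU (subspace_ker (iter i phi))). Qed.

Lemma ker_on_leq i j : (i <= j)%N -> ker_on phi U i `<=` ker_on phi U j.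
Proof.
move=> ij v [Uv v0]; split=> //.
by rewrite -(subnK ij) iterD v0 linear0.
Qed.

Lemma chain_basis_spanW C : is_subspace C -> (forall j, C (phi (w j))) -> W `<=` C.
Proof.
move=> sC Cw v /(AST_surjW ast)[v' + <-].
apply: (dim_quot_ind (subspace_preimage phi sC) w_span Cw) => _ ->.
by rewrite /= linear0; apply: subspace0.
Qed.

(** Induction up the kernels of phi^n on U: modulo the previous kernel and phi(U), each is spanned
    by the tops of chains of length n. *)
Lemma chain_tops_span C : is_subspace C -> (forall i (z : S i), C (b z)) ->
  phi @` U `<=` C -> U `<=` C.
Proof.
move=> sC Cb CU.
suff Cker n : (n <= m)%N -> ker_on phi U n `<=` C.
  by move=> u Uu; apply: (Cker m) => //; split=> //; apply: nilU.
elim: n => [_ v [_ /= ->]|n IH nm]; first exact: subspace0.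
apply: (dim_quot_ind sC (b_span (i := Ordinal nm)) (Cb _)).
move=> _ [x /(IH (ltnW nm)) Cx [_ [y [Uy _] <-] <-]].
by apply: subspaceD => //; apply: CU; exists y.
Qed.

(** Downward induction from phi^m(U) = 0, with [d] bounding m - n: [chain_tops_span] is applied to
    the preimage of [C] under phi^n, where phi^n(phi(U)) is the case n + 1. *)
Lemma chain_tails_span C : is_subspace C ->
  (forall i (z : S i) j, (0 < j <= i)%N -> C (iter j phi (b z))) ->
  phi @` U `<=` C.
Proof.
move=> sC Cb.
suff CU d n u : (m <= n + d)%N -> (0 < n)%N -> U u -> C (iter n phi u).
  by move=> _ [u Uu <-]; apply: (CU m 1).
elim: d n u => [|d IH] n u mn n0 Uu.
  rewrite addn0 in mn; rewrite -(subnK mn) iterD nilU// linear0.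
  exact: subspace0.
apply: (@chain_tops_span (iter n phi @^-1` C)) Uu; first exact: subspace_preimage.
- move=> i z /=; case: (leqP n i) => ni; first by apply: Cb; rewrite n0.
  by rewrite -(subnK ni) iterD (b_ker z).2 linear0; apply: subspace0.
- by move=> _ [v Uv <-] /=; rewrite -iterSr; apply: IH => //; rewrite addSnnS.
Qed.

Definition jordan_index : Type :=
  ('I_r + {s : {i : 'I_m & S i} & 'I_(tag s).+1})%type.

(* On W the basis consists of [phi (w j)] rather than [w j], so that every
   element other than the chain tops [b z] is in the image of [phi]. *)
Definition jordan (x : jordan_index) : V :=
  match x with
  | inl j => phi (w j)
  | inr (existT s j) => iter j phi (b (tagged s))
  end.

(* Rank 0 on W; on U, lexicographic in increasing [j], then decreasing length. *)
Definition jordan_rank (x : jordan_index) : nat :=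
  match x with
  | inl _ => 0
  | inr (existT s j) => (j * m + (m - (tag s).+1)).+1
  end.

(** A preimage of [jordan x] under [phi] or [iter j phi], to which relations within one rank are
    pulled back. *)
Let chain_top (x : jordan_index) : V :=
  match x with
  | inl j => w j
  | inr (existT s _) => b (tagged s)
  end.

Lemma jordan_independent : independent (jordan : {classic jordan_index} -> V).
Proof.
apply: (@graded_independent _ _ {classic jordan_index} jordan jordan_rank)
  => -[j0|[[i z0] j0]] /=.
  exists U; split=> // [[//|[[i z] j]] _ /=|q a uq qW Usum].
    by apply: (AST_iterU ast); case: (b_ker z).
  have qE y : y \in q -> exists j, y = inl j.
    by case: y => [j _|x /qW]; [exists j|case: x].
  apply: (@dim_quot_indep _ _ _ _ _ {classic jordan_index} inl chain_top q a w_ind uq).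
    by move=> _ /qE[j ->]; exists j.
  have Wsum : W (\sum_(y <- q) a y *: chain_top y).
    apply: subspace_sum_seq => // _ /qE[j ->].
    by apply: subspaceZ => //; apply: wW.
  apply: (AST_injW ast) => //; apply: (AST_disjoint ast); first exact: (AST_stableW ast).
  rewrite linear_sum; congr (U _): Usum; apply: eq_big_seq => _ /qE[j ->].
  by rewrite linearZ.
(* Since m - (i' + 1) < m, division by m recovers [j] from the rank. *)
have divE i' j : (i' < m)%N -> ((j * m + (m - i'.+1)) %/ m = j)%N.
  by move=> im; rewrite divnMDl ?divn_small ?addn0//; lia.
have rankE i1 i2 (j1 j2 : nat) : (i1 < m)%N -> (i2 < m)%N ->
    (j1 * m + (m - i1.+1)).+1 = (j2 * m + (m - i2.+1)).+1 -> i1 = i2 /\ j1 = j2.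
  move=> im1 im2 [eqr]; have := congr1 (divn^~ m) eqr.
  by rewrite /= !divE// => jj; split=> //; subst j2; lia.
have rank_lt i1 i2 (j1 j2 : nat) : (i1 < m)%N -> (i2 < m)%N ->
    ((j1 * m + (m - i1.+1)).+1 < (j2 * m + (m - i2.+1)).+1)%N ->
    (j1 < j2)%N \/ (j1 = j2 /\ (i2 < i1)%N).
  move=> im1 im2; rewrite ltnS => ltr; have := leq_div2r m (ltnW ltr).
  rewrite !divE// leq_eqVlt => /orP[/eqP jj|]; last by left.
  by right; split=> //; subst j2; lia.
have sphiU : is_subspace (phi @` U) by exact: subspace_image.
have skphiU := subspace_add (ker_on_subspace i) sphiU.
(* A later position [j] contributes phi^j0 of an element of phi(U); the same position in a shorter
   chain, phi^j0 of an element of ker phi^i. *)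
exists (iter j0 phi @` add_sets (ker_on phi U i) (phi @` U)); split.
- exact: subspace_image.
- move=> [//|[[i' z] j]] /= /rank_lt[]// => [jj|[<- ii]]; last first.
    exists (b z) => //; exists (b z); first exact: (ker_on_leq ii (b_ker z)).
    by exists 0; [exact: subspace0|rewrite addr0].
  exists (phi (iter (j - j0.+1) phi (b z))); last first.
    by rewrite -iterSr -iterD addnC subnK.
  exists 0; first exact: (subspace0 (ker_on_subspace i)).
  exists (phi (iter (j - j0.+1) phi (b z))); last by rewrite add0r.
  exists (iter (j - j0.+1) phi (b z)) => //.
  by apply: (AST_iterU ast); case: (b_ker z).
- move=> q a uq qi [_ [v kv [_ [u Uu <-] <-]]] sumE.
  have qE y : y \in q -> exists z, y = inr (existT _ (existT _ i z) j0).
    case: y => [j /qi//|[[i' z] j] /qi/= /rankE[]// /val_inj ii].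
    by case: _ / (esym ii) z j => z j /val_inj ->; exists z.
  pose y := \sum_(x <- q) a x *: chain_top x.
  have ky : ker_on phi U i.+1 y.
    apply: subspace_sum_seq; first exact: ker_on_subspace.
    move=> _ /qE[z ->]; apply: subspaceZ; first exact: ker_on_subspace.
    exact: b_ker.
  apply: (@dim_quot_indep _ _ _ _ _ {classic jordan_index}
      (fun z => inr (existT _ (existT _ i z) j0)) chain_top q a (@b_ind i) uq).
    by move=> _ /qE[z ->]; exists z.
  (* phi^j0 kills y - phi u - v and j0 <= i, so y - phi u is in ker phi^i. Then phi u is in ker
     phi^(i+1), u in ker phi^(i+2), and y in [mu_denom i]. *)
  have kyu : ker_on phi U i (y - phi u).
    rewrite -(subrK v (y - _)); apply: subspaceD => //; first exact: ker_on_subspace.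
    apply: (@ker_on_leq j0 i); first by rewrite -ltnS.
    split.
      apply: subspaceB => //; last by case: kv.
      by apply: subspaceB; [|case: ky|apply: (AST_stableU ast)].
    rewrite -addrA -opprD linearB /= [phi u + v]addrC sumE; apply/eqP; rewrite subr_eq0.
    rewrite /y linear_sum; apply/eqP/eq_big_seq => _ /qE[z ->] /=.
    by rewrite linearZ.
  exists (y - phi u) => //; exists (phi u); last by rewrite subrK.
  exists u => //; split => //.
  have [_] : ker_on phi U i.+1 (phi u).
    rewrite -[phi u](subKr y); apply: subspaceB => //; first exact: ker_on_subspace.
    exact: (@ker_on_leq i).
  by rewrite -iterSr.
Qed.

Lemma jordan_span C : is_subspace C -> (forall x, C (jordan x)) -> forall v, C v.
Proof.
move=> sC Ce v; have [v1 [v2 [Wv Uv ->]]] := AST_split ast v.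
apply: subspaceD => //.
  by apply: chain_basis_spanW Wv => // j; apply: (Ce (inl j)).
apply: chain_tops_span Uv => // [i z|].
  exact: (Ce (inr (existT _ (existT _ i z) ord0))).
apply: chain_tails_span => // i z j /andP[_ ji]; rewrite -ltnS in ji.
exact: (Ce (inr (existT _ (existT _ i z) (Ordinal ji)))).
Qed.

End JordanBasis.

(** * Algebra of 1GD inverses *)

Section OneGDInverses.
Variables (k : fieldType) (V : lmodType k) (phi : {linear V -> V}).
Implicit Types p : {linear V -> V}.

Lemma X_1GD_inner p : X_1GD phi p -> forall v, phi (p (phi v)) = phi v.
Proof. by move=> [_ [h [g [h1 _ pE _]]]] v; have /= -> := pE v; apply: h1. Qed.

Lemma X_1GD_outer p : X_1GD phi p -> forall v, p (phi (p v)) = p v.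
Proof. by case. Qed.

(** The G-Drazin inverse g commutes with a power of phi whose kernel is U, so it preserves U. As phi
    p = phi g, phi (p u) is in U, and hence so is p u. *)
Lemma X_1GD_stableU W U p :
  AST_decomposition phi W U -> X_1GD phi p -> forall u, U u -> U (p u).
Proof.
move=> ast [_ [h [g [_ [_ [n idx gC]] _ pE]]]] u Uu.
apply: (AST_preimU ast); have /= -> := pE u; apply: (AST_stableU ast).
have Un := AST_ker_iter ast idx; apply/Un.
by have /= <- := gC u; move/Un: Uu => ->; rewrite linear0.
Qed.

Lemma X_1GD_eq p p' : X_1GD phi p -> X_1GD phi p' ->
  (forall v, p (phi v) = p' (phi v)) -> (forall v, phi (p v) = phi (p' v)) ->
  p = p'.
Proof.
move=> Xp Xp' pphi phip; apply: linear_ext => v.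
by rewrite -(X_1GD_outer Xp) phip pphi (X_1GD_outer Xp').
Qed.

(** The witness h phi h is an outer inverse with the same products with phi, on either side, as
    h. *)
Lemma X_1GD_of_inverses h g : X_1 phi h -> X_GD phi g ->
  (forall v, phi (h v) = phi (g v)) ->
  exists2 p, X_1GD phi p &
    (forall v, p (phi v) = h (phi v)) /\ (forall v, phi (p v) = phi (h v)).
Proof.
move=> hX gX hg; have /= hX' v := hX v.
exists (h \o phi \o h : {linear V -> V}).
  split=> [v|]; first by rewrite /= !hX'.
  by exists h, g; split=> // v /=; rewrite hX'.
by split=> v /=; rewrite hX'.
Qed.

End OneGDInverses.

(** * Parametrization of 1GD inverses by their values on the Jordan basis *)

Lemma inj_surj_bijective (A B : Type) (f : A -> B) :
  injective f -> (forall y, exists x, f x = y) -> bijective f.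
Proof.
move=> finj /choice[g fK]; exists g => // x.
by apply: finj; rewrite fK.
Qed.

(** Through this, the coset of p b_s records exactly phi (p b_s). *)
Lemma quot_eq (k : fieldType) (V : lmodType k) (phi : {linear V -> V}) (u v : V) :
  [set u + b | b in ker phi] = [set v + b | b in ker phi] <-> phi u = phi v.
Proof.
split=> [uv|].
  have : [set u + b | b in ker phi] u.
    by exists 0; rewrite ?addr0//; exact: (subspace0 (subspace_ker phi)).
  by rewrite uv => -[b b0 <-]; rewrite linearD [phi b]b0 addr0.
have sub u' v' : phi u' = phi v' ->
    [set u' + b | b in ker phi] `<=` [set v' + b | b in ker phi].
  move=> uv _ [b b0 <-]; exists (u' - v' + b); last by rewrite addrA [v' + _]addrC subrK.
  by rewrite /ker/= linearD linearB uv subrr add0r; exact: b0.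
by move=> uv; apply/seteqP; split; apply: sub.
Qed.

(* The ordinal i : 'I_m stands for the chain length i.+1, so that
   i.+1 ranges over 1, ..., m and (i.+1).-1 = i. *)
Theorem theorem3p23 (k : fieldType) (V : lmodType k) (phi : {linear V -> V})
    (m r : nat) (W U : set V) (S : 'I_m -> Type) :
  finite_potent phi ->
  has_index phi m ->
  AST_decomposition phi W U ->
  has_dim W 'I_r ->
  (forall i : 'I_m, has_mu phi U i.+1 (S i)) ->
  exists F : X_1GD phi ->
      ('I_r -> ker phi) *
      (forall s : {i : 'I_m & S i}, quot U (ker phi) * ('I_(tag s) -> ker phi)),
    bijective F.
Proof.
move=> _ idx ast [w [wW w_ind w_span]] dimS.
pose b i := sval (cid (dimS i)).
have b_ker i (z : S i) : ker_on phi U i.+1 (b i z).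
  by rewrite /b; case: cid => ? [].
have b_ind i (n : nat) (s : 'I_n -> S i) (c : 'I_n -> k) : injective s ->
    add_sets (ker_on phi U i) (phi @` ker_on phi U i.+2)
      (\sum_(j < n) c j *: b i (s j)) -> forall j, c j = 0.
  by rewrite /b; case: cid => ? [_ + _] /=; apply.
have b_span (i : 'I_m) v : ker_on phi U i.+1 v ->
    exists (n : nat) (s : 'I_n -> S i) (c : 'I_n -> k), injective s /\
    add_sets (ker_on phi U i) (phi @` ker_on phi U i.+2)
      (v - \sum_(j < n) c j *: b i (s j)).
  by rewrite /b; case: cid => ? [_ _ +] /=; apply.
have Uker := AST_ker_iter ast idx.
have nilU : nilpotent_on phi U m by move=> u /Uker.
pose e := jordan phi w b.
have e_ind : independent (e : {classic _} -> V) :=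
  jordan_independent ast wW w_ind b_ker b_ind.
have e_span := jordan_span ast nilU w_span b_ker b_span.
have bU i (z : S i) : U (b i z) by case: (b_ker i z).
(* The vectors phi (w j) and the chain entries below the tops span W + phi(U), the image of phi. *)
have im_eq (p p' : {linear V -> V}) : (forall j, p (phi (w j)) = p' (phi (w j))) ->
    (forall (s : {i : 'I_m & S i}) (j : 'I_(tag s)),
      p (phi (iter j phi (b _ (tagged s)))) =
      p' (phi (iter j phi (b _ (tagged s))))) ->
    forall v, p (phi v) = p' (phi v).
  move=> eW eU v; have [v1 [v2 [Wv1 Uv2 ->]]] := AST_split ast v.
  rewrite !linearD; congr (_ + _).
    exact: (chain_basis_spanW ast w_span (subspace_eq p p') eW (AST_stableW ast Wv1)).
  apply: (chain_tails_span nilU b_ker b_span (subspace_eq p p')); last by exists v2.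
  move=> i z [//|j] /= ji.
  exact: (eU (existT _ i z) (Ordinal ji)).
have FW (p : X_1GD phi) v : v - val p (phi v) \in ker phi.
  by apply/mem_set; rewrite /ker/= linearB X_1GD_inner ?subrr//; exact/set_mem/valP.
have FU (p : X_1GD phi) i (z : S i) :
    [set val p (b i z) + x | x in ker phi] \in quot U (ker phi).
  apply/mem_set; exists (val p (b i z)) => //.
  apply: (X_1GD_stableU ast); first exact/set_mem/valP.
  exact: bU.
pose kerF p v : ker phi := exist [in ker phi] _ (FW p v).
pose quotF p i z : quot U (ker phi) := exist [in quot U (ker phi)] _ (FU p i z).
exists (fun p => (fun j => kerF p (w j),
  fun s : {i : 'I_m & S i} => (quotF p _ (tagged s),
    fun j : 'I_(tag s) => kerF p (iter j phi (b _ (tagged s)))))).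
apply: inj_surj_bijective => [p p' [eW eU]|[tW tU]].
  have := set_mem (valP p); have := set_mem (valP p').
  have eW' j : val p (phi (w j)) = val p' (phi (w j)).
    by have /addrI/oppr_inj := congr1 (fun t => val (t j)) eW.
  have eU1 s : phi (val p (b _ (tagged s))) = phi (val p' (b _ (tagged s))).
    by have /quot_eq := congr1 (fun t => val (t s).1) eU.
  have eU2 (s : {i : 'I_m & S i}) (j : 'I_(tag s)) :
      val p (phi (iter j phi (b _ (tagged s)))) =
      val p' (phi (iter j phi (b _ (tagged s)))).
    by have /addrI/oppr_inj := congr1 (fun t => val ((t s).2 j)) eU.
  move=> Xp' Xp; apply: val_inj; apply: (X_1GD_eq Xp Xp'); first exact: im_eq.
  (* Apart from the chain tops, basis vectors lie in the image of phi, where phi p phi = phi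
     decides; on the tops the cosets agree. *)
  apply: e_span => [|[j|[s j]]].
  - exact: (subspace_eq (phi \o val p) (phi \o val p')).
  - by rewrite /= !X_1GD_inner.
  case: (unliftP ord0 j) => [j' ->|->] /=; last exact: eU1.
  by rewrite !X_1GD_inner.
have /choice[u uP] s : exists u, U u /\ val (tU s).1 = [set u + x | x in ker phi].
  by have /set_mem[u Uu uE] := valP (tU s).1; exists u.
have ext (tw : 'I_r -> V) (tu : forall s : {i : 'I_m & S i}, 'I_(tag s) -> V) :
    exists p : {linear V -> V}, [/\ forall j, p (phi (w j)) = tw j,
      forall s : {i : 'I_m & S i}, p (b _ (tagged s)) = u s &
      forall (s : {i : 'I_m & S i}) (j : 'I_(tag s)),
        p (phi (iter j phi (b _ (tagged s)))) = tu s j].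
  (* Position 0 is the chain top; position j' + 1 carries the datum indexed by [j']. *)
  pose t (x : jordan_index r S) := match x with
    | inl j => tw j
    | inr (existT s j) => if unlift ord0 j is Some j' then tu s j' else u s
    end.
  have [p pE] := linear_extension (t : {classic _} -> V) e_ind e_span.
  exists p; split=> [j|s|s j].
  - exact: (pE (inl j)).
  - by have := pE (inr (existT _ s ord0)); rewrite /= unlift_none.
  - by have := pE (inr (existT _ s (lift ord0 j))); rewrite /= liftK.
(* [h] realizes the prescribed data; [g] has the same [phi \o g] but inverts
   [phi] along the chains, so that it commutes with [iter m phi]. *)
have [h [hW hb hU]] := ext (fun j => w j - val (tW j))
  (fun s j => iter j phi (b _ (tagged s)) - val ((tU s).2 j)).
have [g [gW gb gU]] := ext w (fun s j => iter j phi (b _ (tagged s))).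
have kerP (x : ker phi) : phi (val x) = 0 by have := set_mem (valP x).
have hX : X_1 phi h.
  apply: (im_eq (phi \o h) idfun) => [j|s j] /=.
    by rewrite hW linearB kerP subr0.
  by rewrite hU linearB kerP subr0.
have gX : X_GD phi g.
  split; first by apply: (im_eq (phi \o g) idfun) => [j|s j] /=; rewrite ?gW ?gU.
  exists m => //; apply: e_span => [|x].
    exact: (subspace_eq (g \o iter m phi) (iter m phi \o g)).
  (* On W both sides send phi (w j) to phi^m (w j). The chain vectors and their images under [g] lie
     in U, where phi^m vanishes. *)
  have gphiW v : W v -> g (phi v) = v.
    apply: (dim_quot_ind (subspace_eq (g \o phi) idfun) w_span gW) => _ -> /=.
    by rewrite !linear0.
  case: x => [j|[s j]] /=.
    by rewrite gW -iterSr iterS gphiW//; apply: (AST_iterW ast).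
  rewrite nilU ?linear0; last exact: (AST_iterU ast).
  rewrite nilU//; case: (unliftP ord0 j) => [j' ->|->] /=.
    by rewrite gU; apply: (AST_iterU ast).
  by rewrite gb; case: (uP s).
(* On each basis vector [h] and [g] differ by an element of ker phi. *)
have hg v : phi (h v) = phi (g v).
  apply: (e_span _ (subspace_eq (phi \o h) (phi \o g))) => -[j|[s j]] /=.
    by rewrite hW gW linearB kerP subr0.
  case: (unliftP ord0 j) => [j' ->|->] /=; last by rewrite hb gb.
  by rewrite hU gU linearB kerP subr0.
have [p Xp [pphi phip]] := X_1GD_of_inverses hX gX hg.
exists (exist [in X_1GD phi] p (mem_set Xp)); congr (_, _).
  by apply/funext => j; apply: val_inj; rewrite /= pphi hW subKr.
apply: functional_extensionality_dep => s; rewrite [RHS]surjective_pairing.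
congr (_, _).
  by apply: val_inj; rewrite /= (uP s).2; apply/quot_eq; rewrite phip hb.
by apply/funext => j; apply: val_inj; rewrite /= pphi hU subKr.
Qed.
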